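(* Let $G$ be a complete $k$-partite graph with $k\geq 3$. Let $n$ be the largest size of a partition class of $G$, and for $1\le i\le n$ let $a_i$ be the number of partition classes of $G$ of size $i$, so that $\sum_{i=1}^n a_i=k$ and $$I(G;x)=\sum_{i=1}^{n}a_i(1+x)^{i}-(k-1).$$ (i) If the sequence $a_1,a_2,\ldots,a_n$ is positive and log-concave, then $I(G;x)$ is log-concave. (ii) If the subsequence $\{a_i : a_i\neq 0\}$ (taken in order of increasing index $i$) is increasing, then $I(G;x)$ is unimodal.
   Context: All graphs are finite and simple. An independent set of a graph $G$ is a set of pairwise non-adjacent vertices; $\alpha(G)$ is the size of a largest independent set. The independence polynomial is $I(G;x)=\sum_{j=0}^{\alpha(G)}i_j(G)x^j$, where $i_j(G)$ is the number of independent sets of cardinality $j$ in $G$ and $i_0(G)=1$. The complete $k$-partite graph $K_{n_1,\ldots,n_k}$ has vertex set partitioned into $k$ nonempty classes of sizes $n_1,\ldots,n_k$, with two vertices adjacent if and only if they lie in different classes. A sequence $c_0,\ldots,c_r$ of nonnegative numbers is log-concave if $c_j^2\ge c_{j-1}c_{j+1}$ for every interior index $j$; similarly for a sequence indexed from $1$. A polynomial $\sum_{j=0}^r c_jx^j$ with nonnegative coefficients is log-concave if its coefficient sequence is, and unimodal if there is some $m$ with $c_0\le\cdots\le c_m\ge c_{m+1}\ge\cdots\ge c_r$. *)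

(* Defs.v *)
From HB Require Import structures.
From mathcomp Require Import all_boot all_order all_algebra.

Set Implicit Arguments.
Unset Strict Implicit.
Unset Printing Implicit Defensive.

Import Order.TTheory GRing.Theory Num.Theory.
Local Open Scope ring_scope.

Record sgraph := SGraph {
  vertex :> finType;
  adj : rel vertex;
  adj_sym : symmetric adj;
  adj_irr : irreflexive adj
}.

Definition independent (G : sgraph) (S : {set G}) : bool :=
  [forall x in S, forall y in S, ~~ adj x y].

Definition alpha (G : sgraph) : nat :=
  (\max_(S : {set G} | independent S) #|S|)%N.

Definition num_indep (G : sgraph) (j : nat) : nat :=
  #|[set S : {set G} | independent S & #|S| == j]|.

Definition indep_poly (G : sgraph) : {poly int} :=
  \poly_(j < (alpha G).+1) (num_indep G j)%:Z.

(* [partition] already forces the classes to be nonempty. *)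
Definition complete_multipartite (G : sgraph) (k : nat) (P : {set {set G}}) :=
  [/\ partition P [set: G], #|P| = k
    & forall x y : G, adj x y = (pblock P x != pblock P y)].

Definition max_class (T : finType) (P : {set {set T}}) : nat :=
  (\max_(B in P) #|B|)%N.

Definition num_classes (T : finType) (P : {set {set T}}) (i : nat) : nat :=
  #|[set B in P | #|B| == i]|.

(* a_1, ..., a_n: the entry at (0-based) position i of the list is a_(i+1). *)
Definition class_counts (T : finType) (P : {set {set T}}) : seq nat :=
  [seq num_classes P i | i <- iota 1 (max_class P)].

Definition log_concave (c : seq int) : Prop :=
  (forall j : nat, 0 <= c`_j) /\
  (forall j : nat, (0 < j)%N -> (j.+1 < size c)%N ->
     c`_j.-1 * c`_j.+1 <= c`_j ^+ 2).

Definition unimodal (c : seq int) : Prop :=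
  (forall j : nat, 0 <= c`_j) /\
  exists m : nat, [/\ (m < size c)%N,
    forall j : nat, (j < m)%N -> c`_j <= c`_j.+1
    & forall j : nat, (m <= j)%N -> (j.+1 < size c)%N -> c`_j.+1 <= c`_j].

(* A polynomial coerces to its coefficient sequence c_0, ..., c_r, where r is
   its degree. *)
Definition poly_log_concave (p : {poly int}) : Prop := log_concave p.
Definition poly_unimodal (p : {poly int}) : Prop := unimodal p.

(* Main.v *)
Require Import Defs.
From HB Require Import structures.
From mathcomp Require Import all_boot all_order all_algebra.
From mathcomp Require Import zify ring lra.

Set Implicit Arguments.
Unset Strict Implicit.
Unset Printing Implicit Defensive.

Import Order.TTheory GRing.Theory Num.Theory.
Local Open Scope ring_scope.

(** The classes of a complete multipartite graph are its maximal independent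
    sets and they are disjoint, so a nonempty independent set lies in exactly one
    of them. Hence, writing [a_i] for the number of classes of size [i] and [n]
    for the largest size, the number of independent sets of size [j >= 1] is
    [c_j = a_1 'C(1, j) + ... + a_n 'C(n, j)], while the constant coefficient is
    [1] in place of [c_0 = k].

    Log-concavity. The [c_j] are the coefficients of [f (1 + x)], where
    [f = a_1 x + ... + a_n x^n], and the point is that [f |-> f (1 + x)] preserves
    log-concavity ([binomial_transform_log_concave]). The induction writes
    [f = a_0 + x g], so that [f (1 + x) = a_0 + (1 + x) g (1 + x)]. Multiplying by
    [1 + x] is harmless. Adding [a_0] to the constant coefficient only matters
    for the inequalities at the bottom of the sequence; writing [d_j] for the
    coefficients of [g (1 + x)], these follow from [a_0 d_(j+1) <= d_0 d_j]
    ([head_mul_transform_succ]). Combinatorially this is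
    [a_0 a_m <= a_p a_q] for [p + q = m], summed over [p, q >= 1] with weight
    ['C(q - 1, j)]. Finally, replacing [c_0 = k] by [1] keeps
    [c_0 c_2 <= c_1 ^ 2].

    Unimodality. If the nonzero [a_i] increase, all that matters is that [a_n] is
    the largest of the [a_i]. The mode is at [n / 2]. Past it every summand
    [a_i 'C(i, j)] decreases in [j]. Before it, say [2 j + 2 <= n], the increment
    ['C(i, j+1) - 'C(i, j)] is negative only for [i <= 2 j], so lowering [a_i] to
    [0] for [2 j < i < n] and raising it to [a_n] for [i <= 2 j] only decreases
    the total increment. By the hockey-stick identity the resulting sum of
    increments over [i <= 2 j] is ['C(2j+1, j+2) - 'C(2j+1, j+1)], and it is
    outweighed by the increment of the single term [i = n]
    ([bin_increment_lower_bound], [weighted_bin_leq_succ]). *)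

(** * Log-concavity under the substitution of 1 + x *)

(** Log-concavity in the form that excludes internal zeros (total positivity of
    order 2). Unlike the local inequality [a i * a i.+2 <= a i.+1 ^+ 2], it
    passes to products of polynomials without any positivity argument. *)
Definition strongly_log_concave (R : realDomainType) (a : nat -> R) : Prop :=
  forall i j, (i <= j)%N -> a i * a j.+1 <= a i.+1 * a j.

(** The coefficients of [f (1 + x)], for [f] the sum of the [a i * x ^ i] with
    [i < n]. *)
Definition binomial_transform (R : realDomainType) (n : nat) (a : nat -> R)
    (j : nat) : R :=
  \sum_(i < n) a i *+ 'C(i, j).

Lemma binomial_transform_ge0 (R : realDomainType) n (a : nat -> R) j :
  (forall i, 0 <= a i) -> 0 <= binomial_transform n a j.
Proof. by move=> a_ge0; apply: sumr_ge0 => i _; apply: mulrn_wge0. Qed.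

(** This recursion and the next are the identity
    [f (1 + x) = a_0 + (1 + x) g (1 + x)] for [f = a_0 + x g]. *)
Lemma binomial_transform_rec0 (R : realDomainType) n (a : nat -> R) :
  binomial_transform n.+1 a 0 = a 0%N + binomial_transform n (a \o succn) 0.
Proof.
rewrite /binomial_transform big_ord_recl /= bin0 mulr1n; congr (_ + _).
by apply: eq_bigr => i _; rewrite !bin0.
Qed.

Lemma binomial_transform_recS (R : realDomainType) n (a : nat -> R) j :
  binomial_transform n.+1 a j.+1 =
    binomial_transform n (a \o succn) j + binomial_transform n (a \o succn) j.+1.
Proof.
rewrite /binomial_transform big_ord_recl /= bin0n mulr0n add0r -big_split /=.
by apply: eq_bigr => i _; rewrite binS mulrnDr addrC.
Qed.

Lemma strongly_log_concave_shift (R : realDomainType) (a : nat -> R) :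
  strongly_log_concave a -> strongly_log_concave (a \o succn).
Proof. by move=> slc_a i j le_ij; apply: slc_a. Qed.

(** Termwise, since [a 0 * a i.+2 <= a 1 * a i.+1]. *)
Lemma head_mul_transform_shift (R : realDomainType) n (a : nat -> R) j :
  (forall i, 0 <= a i) -> strongly_log_concave a ->
  a 0%N * binomial_transform n (a \o succn \o succn) j <=
    a 1%N * binomial_transform n.+1 (a \o succn) j.
Proof.
move=> a_ge0 slc_a; rewrite /binomial_transform big_ord_recr /= mulrDr.
apply: le_trans (_ : _ <= a 1%N * \sum_(i < n) a i.+1 *+ 'C(i, j)) _.
  rewrite !mulr_sumr; apply: ler_sum => i _.
  by rewrite !mulrnAr lerMn2r slc_a ?orbT.
by rewrite lerDl mulr_ge0 // mulrn_wge0.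
Qed.

(** With [d_j] the transform of the tail of [a], this says [a_0 d_(j+1) <= d_0 d_j].
    Write [b = a_1] and [e] for the transform of the second tail, so that
    [d_0 = b + e_0] and [d_(j+1) = e_j + e_(j+1)]. Then [head_mul_transform_shift]
    gives [a_0 d_(j+1) <= b (d_j + d_(j+1))], where [b d_(j+1) <= e_0 d_j] by
    applying the induction hypothesis to the tail. *)
Lemma head_mul_transform_succ (R : realDomainType) n (a : nat -> R) j :
  (forall i, 0 <= a i) -> strongly_log_concave a ->
  a 0%N * binomial_transform n (a \o succn) j.+1 <=
    binomial_transform n (a \o succn) 0 * binomial_transform n (a \o succn) j.
Proof.
elim: n a j => [|n IHn] a j a_ge0 slc_a.
  by rewrite /binomial_transform !big_ord0 !(mulr0, mul0r).
have s_ge0 i : 0 <= (a \o succn) i by exact: a_ge0.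
have slc_s := strongly_log_concave_shift slc_a.
have h1 := head_mul_transform_shift n j a_ge0 slc_a.
have h2 := head_mul_transform_shift n j.+1 a_ge0 slc_a.
have h3 := IHn _ j s_ge0 slc_s.
rewrite binomial_transform_rec0 binomial_transform_recS.
rewrite binomial_transform_recS in h2.
case: j => [|j] in h1 h2 h3 *.
  rewrite binomial_transform_rec0 in h1 *.
  rewrite /= in h1 h2 h3 *; lra.
have h4 := IHn _ j s_ge0 slc_s.
rewrite binomial_transform_recS in h1 *.
rewrite /= in h1 h2 h3 h4 *; lra.
Qed.

(** Multiplication by [1 + x] gives all the inequalities at [i > 0]. At [i = 0]
    the head [a 0] contributes a term on the left that [head_mul_transform_succ]
    absorbs. *)
Lemma binomial_transform_log_concave (R : realDomainType) n (a : nat -> R) :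
  (forall i, 0 <= a i) -> strongly_log_concave a ->
  strongly_log_concave (binomial_transform n a).
Proof.
elim: n a => [|n IHn] a a_ge0 slc_a i j le_ij.
  by rewrite /binomial_transform !big_ord0 !mul0r.
have s_ge0 k : 0 <= (a \o succn) k by exact: a_ge0.
have slc_s := strongly_log_concave_shift slc_a.
have {IHn} lc := IHn _ s_ge0 slc_s.
have hd k := head_mul_transform_succ n k a_ge0 slc_a.
case: j le_ij => [|j] le_ij; first by case: i le_ij => // _; rewrite mulrC.
case: i le_ij => [|i] le_ij.
  rewrite binomial_transform_rec0 !binomial_transform_recS.
  have := hd j; have := hd j.+1; have := lc 0%N j.+1 isT; have := lc 0%N j isT.
  lra.
rewrite !binomial_transform_recS.
have h1 := lc i.+1 j.+1 le_ij; have h2 := lc i j le_ij.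
have h3 := lc i j.+1 (leqW le_ij).
have [lt_ij | ge_ij] := ltnP i j; first by have := lc i.+1 j lt_ij; lra.
have e : i = j by lia.
rewrite -e in h1 h2 h3 *; lra.
Qed.

(** Positivity is what allows the local inequalities to be chained: multiplying
    [c_i c_j <= c_(i+1) c_(j-1)] by [c_(j-1) c_(j+1) <= c_j ^ 2], one cancels
    [c_(j-1) c_j]. *)
Lemma log_concave_positive_strongly (R : realDomainType) n (c : nat -> R) :
  (forall i, (i < n)%N -> 0 < c i) -> (forall i, (n <= i)%N -> c i = 0) ->
  (forall i, (i.+2 < n)%N -> c i * c i.+2 <= c i.+1 ^+ 2) ->
  strongly_log_concave c.
Proof.
move=> c_gt0 c_eq0 lc i j le_ij.
have c_ge0 k : 0 <= c k.
  by have [/c_gt0/ltW | /c_eq0 ->] := ltnP k n.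
have [lt_jn | ge_jn] := ltnP j.+1 n; last first.
  by rewrite (c_eq0 _ ge_jn) mulr0 mulr_ge0.
have [d def_j] : {d | j = (i + d)%N} by exists (j - i)%N; rewrite subnKC.
rewrite {le_ij}def_j in lt_jn *.
elim: d lt_jn => [|d IHd] lt_jn; first by rewrite addn0 mulrC.
rewrite !addnS in lt_jn *.
have h1 := IHd (ltnW lt_jn).
have h2 := lc (i + d)%N lt_jn.
have p1 : 0 < c (i + d)%N by apply: c_gt0; lia.
have p2 : 0 < c (i + d).+1 by apply: c_gt0; lia.
rewrite -(ler_pM2r (mulr_gt0 p1 p2)).
have q1 := ler_wpM2r (ltW (mulr_gt0 p2 p2)) h1.
have q2 := ler_wpM2l (mulr_ge0 (c_ge0 i) (ltW p2)) h2.
lra.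
Qed.

Lemma strongly_log_concave_cons0 (R : realDomainType) (a : nat -> R) :
  (forall i, 0 <= a i) -> a 0%N = 0 -> strongly_log_concave (a \o succn) ->
  strongly_log_concave a.
Proof.
move=> a_ge0 a0 slc_s [|i] [|j] le_ij //; first by rewrite mulrC.
  by rewrite a0 mul0r mulr_ge0.
exact: (slc_s i j).
Qed.

(** * Weighted sums of binomial coefficients *)

Lemma leq_bin_succ b j : (j.*2 < b)%N -> ('C(b, j) <= 'C(b, j.+1))%N.
Proof.
move=> lt_jb; have := mul_bin_left b j.
have : (j.+1 <= b - j)%N by lia.
move=> h1 h2; rewrite -(leq_pmul2l (ltn0Sn j)) h2.
by rewrite leq_mul2r h1 orbT.
Qed.

Lemma geq_bin_succ b j : (b <= j.*2.+1)%N -> ('C(b, j.+1) <= 'C(b, j))%N.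
Proof.
move=> le_bj; have := mul_bin_left b j.
have : (b - j <= j.+1)%N by lia.
move=> h1 h2; rewrite -(leq_pmul2l (ltn0Sn j)) h2.
by rewrite leq_mul2r h1 orbT.
Qed.

Lemma sum_bin_lt m j : (\sum_(b < m) 'C(b, j))%N = 'C(m, j.+1).
Proof.
elim: m => [|m IHm]; first by rewrite big_ord0.
by rewrite big_ord_recr /= IHm binS.
Qed.

(** Equality holds at [n = 2 j + 2], by symmetry of row [2 j + 1]; from there the
    difference ['C(n, j.+1) - 'C(n, j)] only grows with [n], its increment being
    ['C(n, j) - 'C(n, j.-1)]. *)
Lemma bin_increment_lower_bound j n : (j.+1.*2 <= n)%N ->
  ('C(n, j) + 'C(j.*2.+1, j.+1) <= 'C(n, j.+1) + 'C(j.*2.+1, j.+2))%N.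
Proof.
elim: n => [|n IHn] // le_jn.
have [def_n | neq_jn] := eqVneq n.+1 j.+1.*2.
  have -> : n = j.*2.+1 by lia.
  case: j {IHn le_jn def_n} => [|j] //.
  have sym : 'C(j.+1.*2.+1, j) = 'C(j.+1.*2.+1, j.+3).
    by rewrite -bin_sub; [congr 'C(_, _); lia | lia].
  by rewrite !(binS (_.*2.+1)) sym; lia.
have := IHn ltac:(lia).
case: j {IHn} le_jn neq_jn => [|j] le_jn neq_jn.
  by rewrite !bin0 !bin1; lia.
have := @leq_bin_succ n j ltac:(lia).
by rewrite (binS n j.+1) (binS n j); lia.
Qed.

(** Terms with [b <= 2 j] lose, but no more than they would with weight [a n];
    terms with [2 j < b] gain; and the gain of the term [b = n] covers the
    total loss. *)
Lemma weighted_bin_leq_succ (a : nat -> nat) n j :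
  (j.+1.*2 <= n)%N -> (forall b, (b < n)%N -> (a b <= a n)%N) ->
  (\sum_(b < n.+1) a b * 'C(b, j) <= \sum_(b < n.+1) a b * 'C(b, j.+1))%N.
Proof.
move=> le_jn a_le; pose m := j.*2.+1; have lt_mn : (m < n)%N by lia.
have := leq_mul (leqnn (a n)) (bin_increment_lower_bound le_jn).
rewrite -/m !(mulnDr _ 'C(n, _)) => gap.
rewrite !(big_ord_recr n) /=.
(* Termwise comparison, where the weight is [a n] below [m] and 0 above. *)
have : (\sum_(b < n) a b * 'C(b, j) + a n * \sum_(b < m) 'C(b, j.+1) <=
        \sum_(b < n) a b * 'C(b, j.+1) + a n * \sum_(b < m) 'C(b, j))%N.
  rewrite !(big_ord_widen n (fun b => 'C(b, _)) (ltnW lt_mn)).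
  rewrite !big_distrr /= !(big_mkcond (fun i : 'I_n => (i < m)%N)) /=.
  rewrite -!big_split /=; apply: leq_sum => -[b lt_bn] _ /=.
  case: ltnP => [lt_bm | le_mb].
    have := a_le b lt_bn; have := @geq_bin_succ b j ltac:(lia).
    nia.
  by rewrite !addn0 leq_mul2l leq_bin_succ ?orbT //; lia.
rewrite !sum_bin_lt; move: gap.
move: (a n * 'C(m, _))%N (a n * 'C(m, _))%N (a n * 'C(n, _))%N (a n * 'C(n, _))%N.
move: (\sum_(b < n) _)%N (\sum_(b < n) _)%N; lia.
Qed.

Lemma weighted_bin_geq_succ (a : nat -> nat) n j :
  (n <= j.*2.+1)%N ->
  (\sum_(b < n.+1) a b * 'C(b, j.+1) <= \sum_(b < n.+1) a b * 'C(b, j))%N.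
Proof.
move=> le_nj; apply: leq_sum => -[b lt_bn] _ /=.
by rewrite leq_mul2l geq_bin_succ ?orbT //; lia.
Qed.

Lemma sorted_filter_le_last (c : nat -> nat) n b :
  sorted leq [seq x <- [seq c i | i <- iota 1 n.+1] | x != 0%N] ->
  c n.+1 != 0%N -> (1 <= b <= n.+1)%N -> (c b <= c n.+1)%N.
Proof.
move=> srt cn0 /andP[b_gt0 b_le].
rewrite -[n.+1]addn1 iotaD map_cat /= cats1 add1n filter_rcons cn0 in srt.
rewrite (sorted_pairwise leq_trans) pairwise_rcons in srt.
have [-> // | neq_bn] := eqVneq b n.+1.
have [-> // | cb0] := eqVneq (c b) 0%N.
case/andP: srt => /allP/(_ (c b)) h _; apply: h.
rewrite mem_filter cb0 map_f // mem_iota; lia.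
Qed.

(** * Classes and independent sets *)

Lemma card_leq_max_class (T : finType) (P : {set {set T}}) B :
  B \in P -> (#|B| <= max_class P)%N.
Proof. by move=> PB; rewrite /max_class (bigD1 B) //= leq_maxl. Qed.

Lemma num_classes_gt_max (T : finType) (P : {set {set T}}) i :
  (max_class P < i)%N -> num_classes P i = 0%N.
Proof.
move=> lt_i; apply/eqP; rewrite cards_eq0; apply/eqP/setP => B.
rewrite !inE; apply/negP => /andP[PB /eqP szB].
by move: lt_i; rewrite -szB ltnNge card_leq_max_class.
Qed.

Lemma num_classes_max (T : finType) (P : {set {set T}}) :
  P != set0 -> (0 < num_classes P (max_class P))%N.
Proof.
case/set0Pn => A PA; rewrite card_gt0; apply/set0Pn.
have P_gt0 : (0 < #|P|)%N by apply/card_gt0P; exists A.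
have [B PB mB] := eq_bigmax_cond (fun A : {set T} => #|A|) P_gt0.
by exists B; rewrite inE PB /max_class mB eqxx.
Qed.

Lemma num_classes0 (T : finType) (P : {set {set T}}) :
  set0 \notin P -> num_classes P 0 = 0%N.
Proof.
move=> P0; apply/eqP; rewrite cards_eq0; apply/eqP/setP => B.
rewrite !inE cards_eq0; apply/negP => /andP[PB /eqP B0].
by rewrite -B0 PB in P0.
Qed.

Lemma sum_classes_by_size (T : finType) (P : {set {set T}}) (F : nat -> nat) :
  (\sum_(B in P) F #|B| = \sum_(i < (max_class P).+1) num_classes P i * F i)%N.
Proof.
rewrite (partition_big (fun B : {set T} => inord #|B| : 'I_(max_class P).+1)
           predT) //=.
apply: eq_bigr => i _; rewrite /num_classes -sum1_card big_distrl /=.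
have eqi B : B \in P -> (inord #|B| == i :> 'I_(max_class P).+1) = (#|B| == i).
  move=> PB; rewrite -val_eqE /= inordK //.
  by rewrite ltnS card_leq_max_class.
rewrite [RHS](eq_bigl (fun B =>
    (B \in P) && (inord #|B| == i :> 'I_(max_class P).+1))).
  by apply: eq_bigr => B /andP[PB]; rewrite eqi // mul1n => /eqP ->.
by move=> B; rewrite inE; case PB: (B \in P) => //=; rewrite eqi.
Qed.

Lemma independent_complete_multipartite (G : sgraph) k (P : {set {set G}})
    (S : {set G}) :
  complete_multipartite k P -> S != set0 ->
  independent S = [exists B in P, S \subset B].
Proof.
case=> partP _ adjP /set0Pn[x Sx]; have tiP := partition_trivIset partP.
have covP y : y \in cover P by rewrite (cover_partition partP).
apply/forall_inP/exists_inP => [indS | [B PB sSB] y Sy].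
  exists (pblock P x); first exact: pblock_mem.
  apply/subsetP => y Sy; have /forall_inP/(_ y Sy) := indS x Sx.
  by rewrite adjP negbK eq_pblock.
apply/forall_inP => z Sz; rewrite adjP negbK.
by rewrite !(def_pblock tiP PB) // (subsetP sSB).
Qed.

(** Double counting of the pairs [S \subset B]: as [j > 0], disjointness of the
    classes leaves at most one class [B] for each [S]. *)
Lemma num_indep_complete_multipartite (G : sgraph) k (P : {set {set G}}) j :
  complete_multipartite k P -> (0 < j)%N ->
  num_indep G j = (\sum_(B in P) 'C(#|B|, j))%N.
Proof.
move=> cmP j_gt0; have [partP _ _] := cmP; have tiP := partition_trivIset partP.
rewrite (eq_bigr (fun B : {set G} =>
    \sum_(S : {set G} | (S \subset B) && (#|S| == j)) 1)%N); last first.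
  move=> B _; rewrite -cards_draws -sum1_card.
  by apply: eq_bigl => S; rewrite inE.
rewrite (exchange_big_dep (fun S : {set G} => #|S| == j)) /=; last first.
  by move=> B S _ /andP[].
rewrite /num_indep -sum1_card big_mkcond [RHS]big_mkcond; apply: eq_bigr => S _.
rewrite inE; case: eqP => [szS | _]; last by rewrite andbF.
have S0 : S != set0 by rewrite -card_gt0 szS.
rewrite andbT (independent_complete_multipartite cmP S0).
case: exists_inP => [[B PB sSB] | noB].
  rewrite (big_pred1 B) // => C /=; rewrite andbT.
  apply/andP/eqP => [[PC sSC] | -> //].
  have [x Sx] := set0Pn _ S0.
  rewrite -(def_pblock tiP PB (subsetP sSB x Sx)).
  by rewrite (def_pblock tiP PC (subsetP sSC x Sx)).
rewrite big1 // => B /andP[PB /andP[sSB _]]; by case: noB; exists B.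
Qed.

Lemma num_indep0 (G : sgraph) : num_indep G 0 = 1%N.
Proof.
rewrite -(cards1 (set0 : {set G})); congr #|pred_of_set _|; apply/setP => S.
rewrite !inE cards_eq0; case: eqP => [-> | _]; last by rewrite andbF.
by rewrite andbT; apply/forall_inP => x; rewrite inE.
Qed.

Lemma alpha_complete_multipartite (G : sgraph) k (P : {set {set G}}) :
  complete_multipartite k P -> alpha G = max_class P.
Proof.
move=> cmP; have [partP _ _] := cmP; apply/eqP; rewrite eqn_leq; apply/andP; split.
  apply/bigmax_leqP => S; have [-> | S0] := eqVneq S set0; first by rewrite cards0.
  rewrite (independent_complete_multipartite cmP S0) => /exists_inP[B PB sSB].
  apply: leq_trans (subset_leq_card sSB) _.
  exact: card_leq_max_class.
apply/bigmax_leqP => B PB.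
suff indB : independent B by rewrite /alpha (bigD1 B) //= leq_maxl.
rewrite (independent_complete_multipartite cmP); last first.
  by apply: contraTneq PB => ->; have /and3P[] := partP.
by apply/exists_inP; exists B.
Qed.

(** * Coefficients of the independence polynomial *)

Lemma coef_exprD1X (R : nzRingType) i j : ((1 + 'X : {poly R}) ^+ i)`_j = 'C(i, j)%:R.
Proof.
elim: i j => [|i IHi] j; first by rewrite expr0 coef1 bin0n.
rewrite exprS mulrDl mul1r coefD coefXM IHi.
by case: j => [|j] /=; rewrite ?bin0 ?addr0 // binS natrD IHi.
Qed.

Lemma num_indep_eq_sum (G : sgraph) k (P : {set {set G}}) j :
  complete_multipartite k P -> (0 < j)%N ->
  num_indep G j = (\sum_(i < (max_class P).+1) num_classes P i * 'C(i, j))%N.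
Proof.
move=> cmP j_gt0; rewrite (num_indep_complete_multipartite cmP) //.
exact: (sum_classes_by_size P (fun i => 'C(i, j))).
Qed.

Lemma coef_indep_poly (G : sgraph) k (P : {set {set G}}) j :
  complete_multipartite k P -> (indep_poly G)`_j = (num_indep G j)%:Z.
Proof.
move=> cmP; rewrite coef_poly (alpha_complete_multipartite cmP).
case: ltnP => // lt_j; rewrite (num_indep_eq_sum cmP) ?(leq_ltn_trans _ lt_j) //.
by rewrite big1 // => i _; rewrite bin_small ?muln0 // (leq_trans (ltn_ord i)).
Qed.

Lemma num_indep_transform (G : sgraph) k (P : {set {set G}}) j :
  complete_multipartite k P -> (0 < j)%N ->
  (num_indep G j)%:Z =
    binomial_transform (max_class P).+1 (fun i => (num_classes P i)%:Z) j.
Proof.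
move=> cmP j_gt0; rewrite (num_indep_eq_sum cmP) // /binomial_transform.
rewrite -[LHS]natz natr_sum; apply: eq_bigr => i _.
by rewrite natrM !natz mulrC -[in RHS]mulr_natl natz.
Qed.

Lemma sum_num_classes (T : finType) (P : {set {set T}}) :
  (\sum_(i < (max_class P).+1) num_classes P i = #|P|)%N.
Proof.
rewrite -sum1_card (sum_classes_by_size P (fun=> 1%N)).
by apply: eq_bigr => i _; rewrite muln1.
Qed.

Lemma indep_poly_complete_multipartite (G : sgraph) k (P : {set {set G}}) :
  (0 < k)%N -> complete_multipartite k P ->
  indep_poly G =
    \sum_(1 <= i < (max_class P).+1) (num_classes P i)%:R *: (1 + 'X) ^+ i
      - (k.-1)%:R.
Proof.
move=> k_gt0 cmP; have [/and3P[_ _ P0] cardP _] := cmP.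
apply/polyP => j; rewrite (coef_indep_poly _ cmP) coefB coef_sum.
have -> : \sum_(1 <= i < (max_class P).+1)
            ((num_classes P i)%:R *: (1 + 'X : {poly int}) ^+ i)`_j =
          (\sum_(i < (max_class P).+1) num_classes P i * 'C(i, j))%N%:R.
  rewrite natr_sum -(big_mkord predT (fun i => (num_classes P i * 'C(i, j))%:R)).
  rewrite [RHS]big_ltn // num_classes0 // mul0n add0r.
  by apply: eq_bigr => i _; rewrite coefZ coef_exprD1X natrM.
rewrite -polyCMn coefC; case: j => [|j] /=.
  rewrite num_indep0 (eq_bigr (fun i : 'I__ => num_classes P i)); last first.
    by move=> i _; rewrite bin0 muln1.
  by rewrite sum_num_classes cardP -{1}(prednK k_gt0) -natr1; ring.
by rewrite subr0 (num_indep_eq_sum cmP) // natz.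
Qed.

(** * Log-concavity and unimodality of the independence polynomial *)

(** The counts [a_1, ..., a_n] are preceded by [a_0 = 0] so that the coefficients
    are a binomial transform. The constant coefficient [1] is smaller than the
    transform's [k], which only helps. *)
Lemma indep_poly_log_concave (G : sgraph) k (P : {set {set G}}) :
  (0 < k)%N -> complete_multipartite k P ->
  all (fun a : nat => (0 < a)%N) (class_counts P) ->
  log_concave [seq a%:Z | a : nat <- class_counts P] ->
  poly_log_concave (indep_poly G).
Proof.
move=> k_gt0 cmP pos [_ lc]; have [/and3P[_ _ P0] cardP _] := cmP.
have counts_nth i : (i < max_class P)%N ->
    nth 0%N (class_counts P) i = num_classes P i.+1.
  by move=> lt_i; rewrite (nth_map 0%N) ?size_iota // nth_iota.
have size_counts : size (class_counts P) = max_class P.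
  by rewrite size_map size_iota.
pose a i := (num_classes P i)%:Z.
have a_ge0 i : 0 <= a i by [].
have slc_a : strongly_log_concave a.
  apply: strongly_log_concave_cons0 => //; first by rewrite /a num_classes0.
  apply: (@log_concave_positive_strongly _ (max_class P)) => [i lt_i | i le_i | i lt_i].
  - have /allP/(_ (nth 0%N (class_counts P) i)) := pos.
    by rewrite mem_nth ?size_counts // counts_nth // => /(_ isT); rewrite /a ltz_nat.
  - by rewrite /a /= num_classes_gt_max.
  - have := lc i.+1 isT; rewrite size_map size_counts => /(_ lt_i).
    have lt_i1 := ltnW lt_i; have lt_i0 := ltnW lt_i1.
    by rewrite !(nth_map 0%N 0 Posz) ?size_counts //= !counts_nth.
pose c := binomial_transform (max_class P).+1 a.
have slc_c : strongly_log_concave c by apply: binomial_transform_log_concave.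
have c_ge0 j : 0 <= c j by apply: binomial_transform_ge0.
split=> [j | [//|j] _ _ /=]; first by rewrite (coef_indep_poly _ cmP).
rewrite !(coef_indep_poly _ cmP) expr2; case: j => [|j]; last first.
  by rewrite !(num_indep_transform cmP) //; apply: (slc_c j.+1 j.+2).
rewrite num_indep0 !(num_indep_transform cmP) //.
apply: le_trans (slc_c 0%N 1%N isT).
apply: ler_wpM2r => //; rewrite /c /binomial_transform.
have -> : \sum_(i < (max_class P).+1) a i *+ 'C(i, 0) = k%:Z.
  rewrite -cardP -(sum_num_classes P) -[RHS]natz natr_sum.
  by apply: eq_bigr => i _; rewrite bin0 natz.
by rewrite lez_nat.
Qed.

(** The mode is [n / 2], except when [n = 1]: the polynomial is then [1 + k x],
    whence the maximum with [1]. The step from degree [0] to [1] is treated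
    apart, the constant coefficient being [1] and not a weighted binomial sum. *)
Lemma indep_poly_unimodal (G : sgraph) k (P : {set {set G}}) :
  (1 < k)%N -> complete_multipartite k P ->
  sorted leq [seq a : nat <- class_counts P | a != 0%N] ->
  poly_unimodal (indep_poly G).
Proof.
move=> k_gt1 cmP srt; have [/and3P[_ _ P0] cardP _] := cmP.
have Pn0 : P != set0 by rewrite -card_gt0 cardP; lia.
have last_gt0 := num_classes_max Pn0.
case def_n: (max_class P) last_gt0 => [|n] last_gt0.
  by rewrite num_classes0 in last_gt0.
have a_le b : (b <= n.+1)%N -> (num_classes P b <= num_classes P n.+1)%N.
  case: b => [|b] le_bn; first by rewrite num_classes0.
  apply: sorted_filter_le_last; last by [].
    by rewrite /class_counts def_n in srt.
  by rewrite -lt0n.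
have num_indepE j : (0 < j)%N ->
    num_indep G j = (\sum_(i < n.+2) num_classes P i * 'C(i, j))%N.
  by move=> j_gt0; rewrite (num_indep_eq_sum cmP) // def_n.
have size_p : (n.+1 < size (indep_poly G))%N.
  rewrite ltnNge; apply/negP => /leq_sizeP/(_ n.+1 (leqnn _)).
  rewrite (coef_indep_poly _ cmP) num_indepE // big_ord_recr /= binn muln1.
  by move=> /eqP; rewrite eqz_nat addn_eq0 (gtn_eqF last_gt0) andbF.
have deg1 : (num_indep G 0 <= num_indep G 1)%N.
  rewrite num_indep0 num_indepE // big_ord_recr addn_gt0 bin1 muln_gt0.
  by rewrite last_gt0 orbT.
split=> [j | ]; first by rewrite (coef_indep_poly _ cmP).
exists (maxn 1 n.+1./2); split=> [|j lt_jm | j le_mj _].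
    by apply: leq_ltn_trans size_p; lia.
  rewrite !(coef_indep_poly _ cmP) lez_nat.
  case: j lt_jm => [|j] lt_jm //; rewrite !num_indepE //.
  apply: weighted_bin_leq_succ => [|b lt_bn]; first by lia.
  by apply: a_le; lia.
rewrite !(coef_indep_poly _ cmP) lez_nat !num_indepE //; last by lia.
by apply: weighted_bin_geq_succ; lia.
Qed.

Theorem theorem3p1 (G : sgraph) (k : nat) (P : {set {set G}})
    (hk : (3 <= k)%N) (hG : complete_multipartite k P) :
  [/\ (\sum_(1 <= i < (max_class P).+1) num_classes P i)%N = k,
      indep_poly G =
        \sum_(1 <= i < (max_class P).+1)
           (num_classes P i)%:R *: (1 + 'X) ^+ i - (k.-1)%:R,
      all (fun a : nat => (0 < a)%N) (class_counts P) ->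
        log_concave [seq a%:Z | a : nat <- class_counts P] ->
        poly_log_concave (indep_poly G)
    & sorted leq [seq a : nat <- class_counts P | a != 0%N] ->
        poly_unimodal (indep_poly G)].
Proof.
have [/and3P[_ _ P0] cardP _] := hG; have k_gt1 : (1 < k)%N by lia.
have k_gt0 := ltnW k_gt1; split.
- rewrite -cardP -(sum_num_classes P) -(big_mkord predT (num_classes P)).
  by rewrite [RHS]big_ltn // num_classes0 // add0n.
- exact: indep_poly_complete_multipartite k_gt0 hG.
- exact: indep_poly_log_concave k_gt0 hG.
- exact: indep_poly_unimodal k_gt1 hG.
Qed.
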